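(* Let $K$ be an algebraically closed field and let $L_\infty$ be the Leibniz $K$-algebra with basis $\{e_1,e_2,\dots\}$ and multiplication $e_ie_1=e_{i+1}$ for all $i\ge1$, all other products of basis elements being zero. Let $f(x_1,\dots,x_m)\in\mathcal D(X)$ be a multihomogeneous polynomial of multidegree $(d_1,\dots,d_m)$, with $d_i\ge1$ for all $i$, and let $d=d_1+\cdots+d_m$. Write $f$ modulo $\mathrm{Id}(L_\infty)$ as $$f(x_1,\dots,x_m)=\sum_{j=1}^m\alpha_j\,x_jx_1^{(d_1)}\cdots x_{j-1}^{(d_{j-1})}x_j^{(d_j-1)}x_{j+1}^{(d_{j+1})}\cdots x_m^{(d_m)},\qquad \alpha_j\in K .$$ 1. If $f$ is a polynomial identity for $L_\infty$, then the image of $f$ on $L_\infty$ is $\{0\}$. 2. If $f$ is not a polynomial identity for $L_\infty$ and $\sum_{i=1}^m\alpha_i=0$, then the image of $f$ on $L_\infty$ is $(L_\infty)^{d+1}$. 3. If $f$ is not a polynomial identity for $L_\infty$ and $\sum_{i=1}^m\alpha_i\ne0$, then: (a) if there exists $j$ such that $d_j=1$ and $\alpha_j\neq0$, then the image of $f$ on $L_\infty$ is $(L_\infty)^d$; (b) if $\alpha_j=0$ for all $j$ such that $d_j=1$, then the image of $f$ on $L_\infty$ is $\{0\}\cup(\dot K\cdot e_d+(L_\infty)^{d+1})$.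
   Context: A Leibniz algebra over $K$ is a (not necessarily associative) $K$-algebra satisfying $x(yz)=(xy)z-(xz)y$ for all $x,y,z$. For a Leibniz algebra $L$ put $L^1=L$ and $L^{k+1}=L^kL$. $\mathcal D(X)$ is the free Leibniz $K$-algebra on $X=\{x_1,x_2,\dots\}$; its elements are called polynomials. A polynomial is multihomogeneous of multidegree $(d_1,\dots,d_m)$ if it is a linear combination of monomials having degree $d_i$ in $x_i$ for each $i=1,\dots,m$ (and involving no other variables). A polynomial identity of $L$ is a polynomial vanishing under all evaluations in $L$; $\mathrm{Id}(L)$ is the set of these. Products without brackets are left-normed, and $ab^{(s)}=(\cdots((ab)b)\cdots)b$ with $s$ factors $b$ (omitted if $s=0$). Every multihomogeneous polynomial of multidegree $(d_1,\dots,d_m)$ can be written modulo $\mathrm{Id}(L_\infty)$ in the form displayed in the claim. The image of $f$ on $L$ is $\{f(a_1,\dots,a_m):a_i\in L\}$. $\dot K=K\setminus\{0\}$, and $\dot K\cdot e_d+(L_\infty)^{d+1}=\{\lambda e_d+v:\lambda\in\dot K,\ v\in (L_\infty)^{d+1}\}$. *)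

(* Defs.v *)
From HB Require Import structures.
From mathcomp Require Import all_boot all_order all_algebra.
From mathcomp Require Import boolp classical_sets.

Set Implicit Arguments.
Unset Strict Implicit.
Unset Printing Implicit Defensive.

Import GRing.Theory.
Local Open Scope classical_set_scope.
Local Open Scope ring_scope.

HB.mixin Record Lmodule_isNonassocAlgebra (K : fieldType) V
    of GRing.Lmodule K V := {
  lmul : V -> V -> V;
  lmul_linear_l : forall y, linear (fun x => lmul x y);
  lmul_linear_r : forall x, linear (lmul x)
}.

#[short(type="nonassocAlgType")]
HB.structure Definition NonassocAlgebra (K : fieldType) :=
  { V of GRing.Lmodule K V & Lmodule_isNonassocAlgebra K V }.

Notation "x ** y" := (lmul x y) (at level 40, left associativity) : ring_scope.

HB.mixin Record NonassocAlgebra_isLeibniz (K : fieldType) L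
    of NonassocAlgebra K L := {
  leibnizP : forall x y z : L, x ** (y ** z) = (x ** y) ** z - (x ** z) ** y
}.

#[short(type="leibnizType")]
HB.structure Definition Leibniz (K : fieldType) :=
  { L of NonassocAlgebra K L & NonassocAlgebra_isLeibniz K L }.

(* a b^(s) = (...((a b) b)...) b, with s factors b *)
Definition mulpow (K : fieldType) (L : nonassocAlgType K) (a b : L) (s : nat) :=
  iter s (fun x => x ** b) a.

Definition lspan (K : fieldType) (V : lmodType K) (A : set V) : set V :=
  [set v | exists s : seq (K * V),
     (forall p, p \in s -> A p.2) /\ v = \sum_(p <- s) p.1 *: p.2].

Definition setmul (K : fieldType) (L : nonassocAlgType K) (A B : set L) :
  set L := lspan [set z | exists x y, [/\ A x, B y & z = x ** y]].

(* L^1 = L and L^(k+1) = L^k L; the value L^0 = L is a dummy. *)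
Fixpoint lpow (K : fieldType) (L : nonassocAlgType K) (n : nat) : set L :=
  match n with
  | 0 | 1 => setT
  | n'.+1 => setmul (@lpow K L n') setT
  end.
Arguments lpow {K} L n.

(* The free Leibniz algebra on a countable set of variables is the set of      *)
(* terms in the operations of a K-algebra, modulo the smallest congruence that *)
(* contains the axioms of modules, bilinearity, and the Leibniz identity.      *)
(* TVar i stands for the variable written x_(i+1) on paper.                    *)

Inductive term (K : Type) : Type :=
| TVar of nat
| TZero
| TAdd of term K & term K
| TScale of K & term K
| TMul of term K & term K.
Arguments TVar {K}.
Arguments TZero {K}.

HB.instance Definition _ (K : Type) := gen_eqMixin (term K).
HB.instance Definition _ (K : Type) := gen_choiceMixin (term K).

Inductive teq (K : fieldType) : term K -> term K -> Prop :=
| teq_refl t : teq t t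
| teq_sym t u : teq t u -> teq u t
| teq_trans t u v : teq t u -> teq u v -> teq t v
| teq_add t t' u u' : teq t t' -> teq u u' -> teq (TAdd t u) (TAdd t' u')
| teq_scale c t t' : teq t t' -> teq (TScale c t) (TScale c t')
| teq_mul t t' u u' : teq t t' -> teq u u' -> teq (TMul t u) (TMul t' u')
| teq_addA t u v : teq (TAdd t (TAdd u v)) (TAdd (TAdd t u) v)
| teq_addC t u : teq (TAdd t u) (TAdd u t)
| teq_add0 t : teq (TAdd TZero t) t
| teq_addN t : teq (TAdd (TScale (-1) t) t) TZero
| teq_scaleA a b t : teq (TScale a (TScale b t)) (TScale (a * b) t)
| teq_scale1 t : teq (TScale 1 t) t
| teq_scaleDr a t u :
    teq (TScale a (TAdd t u)) (TAdd (TScale a t) (TScale a u))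
| teq_scaleDl a b t :
    teq (TScale (a + b) t) (TAdd (TScale a t) (TScale b t))
| teq_mulDl t u v : teq (TMul (TAdd t u) v) (TAdd (TMul t v) (TMul u v))
| teq_mulDr t u v : teq (TMul v (TAdd t u)) (TAdd (TMul v t) (TMul v u))
| teq_mulZl a t u : teq (TMul (TScale a t) u) (TScale a (TMul t u))
| teq_mulZr a t u : teq (TMul t (TScale a u)) (TScale a (TMul t u))
| teq_leibniz t u v :
    teq (TMul t (TMul u v))
        (TAdd (TMul (TMul t u) v) (TScale (-1) (TMul (TMul t v) u))).

Section FreeLeibniz.
Variable K : fieldType.
Local Open Scope quotient_scope.

Definition teqb (t u : term K) : bool := `[< teq t u >].

Lemma teqb_equiv : equiv_class_of teqb.
Proof.
split=> [t|t u|u t v].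
- by apply/asboolP; apply: teq_refl.
- by apply/asboolP/asboolP; apply: teq_sym.
- by move=> /asboolP tu /asboolP uv; apply/asboolP; apply: teq_trans tu uv.
Qed.

Canonical teqb_equiv_rel := EquivRelPack teqb_equiv.
Canonical teqb_encModRel := defaultEncModRel teqb.

Definition freeLeib := {eq_quot teqb}.
HB.instance Definition _ := Choice.on freeLeib.
HB.instance Definition _ := EqQuotient.on freeLeib.

Definition fl_class (t : term K) : freeLeib := \pi_freeLeib t.

Lemma fl_classP t u : fl_class t = fl_class u <-> teq t u.
Proof.
rewrite /fl_class; split=> [/eqmodP/asboolP //|tu].
by apply/eqmodP/asboolP.
Qed.

Lemma teq_repr t : teq (repr (fl_class t)) t.
Proof. by apply/fl_classP; rewrite /fl_class reprK. Qed.

Lemma fl_ind (P : freeLeib -> Prop) : (forall t, P (fl_class t)) -> forall f, P f.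
Proof. by move=> Pt f; rewrite -[f]reprK; apply: Pt. Qed.

Definition fl_add (f g : freeLeib) := fl_class (TAdd (repr f) (repr g)).
Definition fl_scale c (f : freeLeib) := fl_class (TScale c (repr f)).
Definition fl_mul (f g : freeLeib) := fl_class (TMul (repr f) (repr g)).
Definition fl_opp f := fl_scale (-1) f.

Lemma fl_addE t u : fl_add (fl_class t) (fl_class u) = fl_class (TAdd t u).
Proof. by apply/fl_classP/teq_add; apply: teq_repr. Qed.
Lemma fl_scaleE c t : fl_scale c (fl_class t) = fl_class (TScale c t).
Proof. by apply/fl_classP/teq_scale; apply: teq_repr. Qed.
Lemma fl_mulE t u : fl_mul (fl_class t) (fl_class u) = fl_class (TMul t u).
Proof. by apply/fl_classP/teq_mul; apply: teq_repr. Qed.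

Let flE := (fl_addE, fl_scaleE, fl_mulE).

Fact fl_addA : associative fl_add.
Proof.
elim/fl_ind=> t; elim/fl_ind=> u; elim/fl_ind=> v.
by rewrite !flE; apply/fl_classP/teq_addA.
Qed.
Fact fl_addC : commutative fl_add.
Proof.
by elim/fl_ind=> t; elim/fl_ind=> u; rewrite !flE; apply/fl_classP/teq_addC.
Qed.
Fact fl_add0 : left_id (fl_class TZero) fl_add.
Proof. by elim/fl_ind=> t; rewrite !flE; apply/fl_classP/teq_add0. Qed.
Fact fl_addN : left_inverse (fl_class TZero) fl_opp fl_add.
Proof. by elim/fl_ind=> t; rewrite /fl_opp !flE; apply/fl_classP/teq_addN. Qed.

HB.instance Definition _ :=
  GRing.isZmodule.Build freeLeib fl_addA fl_addC fl_add0 fl_addN.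

Fact fl_scaleA a b f : fl_scale a (fl_scale b f) = fl_scale (a * b) f.
Proof. by elim/fl_ind: f => t; rewrite !flE; apply/fl_classP/teq_scaleA. Qed.
Fact fl_scale1 : left_id 1 fl_scale.
Proof. by elim/fl_ind=> t; rewrite !flE; apply/fl_classP/teq_scale1. Qed.
Fact fl_scaleDr : right_distributive fl_scale +%R.
Proof.
move=> a; elim/fl_ind=> t; elim/fl_ind=> u; rewrite /GRing.add /= !flE.
by apply/fl_classP/teq_scaleDr.
Qed.
Fact fl_scaleDl f : {morph fl_scale^~ f : a b / a + b}.
Proof.
move=> a b; elim/fl_ind: f => t.
rewrite [RHS]/GRing.add /= !flE; exact/fl_classP/teq_scaleDl.
Qed.

HB.instance Definition _ := GRing.Zmodule_isLmodule.Build K freeLeib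
  fl_scaleA fl_scale1 fl_scaleDr fl_scaleDl.

Lemma fl_classD t u : fl_class (TAdd t u) = fl_class t + fl_class u.
Proof. by rewrite -fl_addE. Qed.
Lemma fl_classZ c t : fl_class (TScale c t) = c *: fl_class t.
Proof. by rewrite -fl_scaleE. Qed.

Fact fl_mul_linear_l g : linear (fun f => fl_mul f g).
Proof.
move=> a; elim/fl_ind=> t; elim/fl_ind=> u; elim/fl_ind: g => v.
rewrite -fl_classZ -fl_classD !flE -fl_classZ -fl_classD; apply/fl_classP.
apply: teq_trans (teq_mulDl _ _ _) _; apply: teq_add (teq_refl _).
exact: teq_mulZl.
Qed.
Fact fl_mul_linear_r f : linear (fl_mul f).
Proof.
move=> a; elim/fl_ind=> t; elim/fl_ind=> u; elim/fl_ind: f => v.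
rewrite -fl_classZ -fl_classD !flE -fl_classZ -fl_classD; apply/fl_classP.
apply: teq_trans (teq_mulDr _ _ _) _; apply: teq_add (teq_refl _).
exact: teq_mulZr.
Qed.

HB.instance Definition _ := Lmodule_isNonassocAlgebra.Build K freeLeib
  fl_mul_linear_l fl_mul_linear_r.

Lemma fl_classM t u : fl_class (TMul t u) = fl_class t ** fl_class u.
Proof. by rewrite -fl_mulE. Qed.

Fact fl_leibniz (f g h : freeLeib) : f ** (g ** h) = (f ** g) ** h - (f ** h) ** g.
Proof.
elim/fl_ind: f => t; elim/fl_ind: g => u; elim/fl_ind: h => v.
rewrite -scaleN1r -!fl_classM -fl_classZ -fl_classD.
exact/fl_classP/teq_leibniz.
Qed.

HB.instance Definition _ := NonassocAlgebra_isLeibniz.Build K freeLeib fl_leibniz.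

Definition fl_var (i : nat) : freeLeib := fl_class (TVar i).

Section Eval.
Variables (L : leibnizType K) (a : nat -> L).

Fixpoint teval (t : term K) : L :=
  match t with
  | TVar i => a i
  | TZero => 0
  | TAdd t u => teval t + teval u
  | TScale c t => c *: teval t
  | TMul t u => teval t ** teval u
  end.

Definition eval (f : freeLeib) : L := teval (repr f).

Lemma teval_teq t u : teq t u -> teval t = teval u.
Proof.
have Dl (x y z : L) : (x + y) ** z = x ** z + y ** z.
  by have := lmul_linear_l z 1 x y; rewrite !scale1r.
have Dr (x y z : L) : z ** (x + y) = z ** x + z ** y.
  by have := lmul_linear_r z 1 x y; rewrite !scale1r.
have M0l (x : L) : 0 ** x = 0.
  by apply: (addrI (0 ** x)); rewrite -Dl !addr0.
have M0r (x : L) : x ** 0 = 0.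
  by apply: (addrI (x ** 0)); rewrite -Dr !addr0.
elim=> //=.
- by move=> ? ? ? _ -> _ ->.
- by move=> ? ? ? ? _ -> _ ->.
- by move=> ? ? ? _ ->.
- by move=> ? ? ? ? _ -> _ ->.
- by move=> *; rewrite addrA.
- by move=> *; rewrite addrC.
- by move=> *; rewrite add0r.
- by move=> *; rewrite scaleN1r addNr.
- by move=> *; rewrite scalerA.
- by move=> *; rewrite scale1r.
- by move=> *; rewrite scalerDr.
- by move=> *; rewrite scalerDl.
- by move=> c x y; have := lmul_linear_l (teval y) c (teval x) 0; rewrite M0l !addr0.
- by move=> c x y; have := lmul_linear_r (teval x) c (teval y) 0; rewrite M0r !addr0.
- by move=> *; rewrite scaleN1r leibnizP.
Qed.

Lemma eval_class t : eval (fl_class t) = teval t.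
Proof. exact/teval_teq/teq_repr. Qed.

Lemma eval_var i : eval (fl_var i) = a i.
Proof. exact: eval_class. Qed.

Lemma eval_is_linear : linear eval.
Proof.
move=> c; elim/fl_ind=> t; elim/fl_ind=> u.
by rewrite -fl_classZ -fl_classD !eval_class.
Qed.

HB.instance Definition _ := GRing.isLinear.Build K freeLeib L _ eval eval_is_linear.

Lemma evalM f g : eval (f ** g) = eval f ** eval g.
Proof.
by elim/fl_ind: f => t; elim/fl_ind: g => u; rewrite -fl_classM !eval_class.
Qed.

(* With the three lemmas above, the universal property of freeLeib. *)
Lemma eval_unique (phi : {linear freeLeib -> L}) :
  {morph phi : f g / f ** g} -> (forall i, phi (fl_var i) = a i) -> phi =1 eval.
Proof.
move=> phiM phiV; elim/fl_ind=> t; rewrite eval_class.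
elim: t => [i||t IHt u IHu|c t IHt|t IHt u IHu] /=.
- exact: phiV.
- exact: linear0.
- by rewrite fl_classD linearD IHt IHu.
- by rewrite fl_classZ linearZ /= IHt.
- by rewrite fl_classM phiM IHt IHu.
Qed.

End Eval.

End FreeLeibniz.

Inductive monomial : Type := MVar of nat | MMul of monomial & monomial.

Fixpoint mono (K : fieldType) (w : monomial) : freeLeib K :=
  match w with
  | MVar i => fl_var K i
  | MMul v w => mono K v ** mono K w
  end.

Fixpoint mdeg (i : nat) (w : monomial) : nat :=
  match w with
  | MVar j => (i == j)%N
  | MMul v w => (mdeg i v + mdeg i w)%N
  end.

(* The variables x_1, ..., x_m have indices 0, ..., m-1. *)
Definition multihomogeneous (K : fieldType) (m : nat) (d : 'I_m -> nat)
    (f : freeLeib K) : Prop :=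
  lspan [set g | exists w, [/\ forall i : 'I_m, mdeg i w = d i,
                               forall i, (m <= i)%N -> mdeg i w = 0%N
                             & g = mono K w]] f.

Definition Id (K : fieldType) (L : leibnizType K) : set (freeLeib K) :=
  [set f | forall a : nat -> L, eval a f = 0].

(* The padding by 0 is immaterial when f only involves x_1, ..., x_m. *)
Definition poly_image (K : fieldType) (L : leibnizType K) (m : nat)
    (f : freeLeib K) : set L :=
  [set v | exists a : m.-tuple L, eval (nth 0 a) f = v].
Arguments poly_image {K} L m f.

(* x_j x_1^(d_1) ... x_j^(d_j - 1) ... x_m^(d_m) *)
Definition normal_mono (K : fieldType) (m : nat) (d : 'I_m -> nat) (j : 'I_m) :
    freeLeib K :=
  foldl (fun g (i : 'I_m) =>
      mulpow g (fl_var K i) (if i == j then (d i).-1 else d i))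
    (fl_var K j) (enum 'I_m).

(* L_oo is realised on {poly K}, whose basis vector 'X^i plays the part of     *)
(* e_(i+1); the product extends e_i e_1 = e_(i+1), e_i e_j = 0 for j <> 1      *)
(* bilinearly.                                                                 *)

Definition Linf (K : fieldType) : Type := {poly K}.

Section Linf.
Variable K : fieldType.

HB.instance Definition _ := GRing.Lmodule.on (Linf K).

Definition Linf_e (i : nat) : Linf K := ('X^(i.-1) : {poly K}).

Definition Linf_mul (u v : Linf K) : Linf K :=
  ((v : {poly K})`_0 *: ((u : {poly K}) * 'X) : {poly K}).

Fact Linf_mul_linear_l v : linear (fun u => Linf_mul u v).
Proof.
have lin (a c : K) (u w : {poly K}) :
    c *: ((a *: u + w) * 'X) = a *: (c *: (u * 'X)) + c *: (w * 'X).
  by rewrite mulrDl -scalerAl scalerDr !scalerA mulrC.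
by move=> a u w; apply: lin.
Qed.
Fact Linf_mul_linear_r u : linear (Linf_mul u).
Proof.
have lin (a : K) (t v w : {poly K}) :
    (a *: v + w)`_0 *: (t * 'X) = a *: (v`_0 *: (t * 'X)) + w`_0 *: (t * 'X).
  by rewrite coefD coefZ scalerDl -scalerA.
by move=> a v w; apply: lin.
Qed.

HB.instance Definition _ := Lmodule_isNonassocAlgebra.Build K (Linf K)
  Linf_mul_linear_l Linf_mul_linear_r.

Fact Linf_leibniz (x y z : Linf K) : x ** (y ** z) = (x ** y) ** z - (x ** z) ** y.
Proof.
rewrite /lmul /= /Linf_mul coefZ coefMX eqxx mulr0 scale0r.
rewrite -!scalerAl !scalerA [X in _ - X *: _]mulrC.
by apply/esym; apply: subrr.
Qed.

HB.instance Definition _ := NonassocAlgebra_isLeibniz.Build K (Linf K) Linf_leibniz.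

Lemma Linf_eM i j : (0 < i)%N -> (0 < j)%N ->
  Linf_e i ** Linf_e j = if j == 1%N then Linf_e i.+1 else 0.
Proof.
case: i j => [//|i] [//|j] _ _.
rewrite /lmul /= /Linf_mul /Linf_e /= coefXn -exprSr eqSS eq_sym.
by case: (j == 0)%N; rewrite ?scale1r ?scale0r.
Qed.

Lemma Linf_basis (v : Linf K) : exists! c : {poly K},
  v = \sum_(i < size c) c`_i *: Linf_e i.+1.
Proof.
have E (c : {poly K}) : \sum_(i < size c) c`_i *: Linf_e i.+1 = (c : Linf K).
  by rewrite -[RHS]coefK poly_def.
by exists v; split=> [|c ->]; rewrite E.
Qed.

End Linf.

(* Main.v *)
Require Import Defs.
From HB Require Import structures.
From mathcomp Require Import all_boot all_order all_algebra.
From mathcomp Require Import boolp classical_sets.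

Import GRing.Theory.
Local Open Scope classical_set_scope.
Local Open Scope ring_scope.

(** In [{poly K}] the product of the algebra is [u ** v = v(0) u X], so a right
    factor only matters through its constant coefficient.  Hence, with
    [b i = (a i)(0)] and [n] the total degree, the polynomial [f] takes the value
      [(\sum_j alpha_j w_j a_j) X^(n-1)],
    where [w_j] is the product of the [b i ^ d i] divided by one factor [b j]
    ([eval_normal_form]).  The constant coefficient of the sum is
    [(\sum_j alpha_j) \prod_i b i ^ d i] ([normal_value_coef0]), and [L^(k+1)] is
    the ideal generated by [X^k] ([lpow_LinfP]); this gives the upper bounds on
    the image.  One of them needs more: when [s = \sum_j alpha_j] is nonzero and
    only the [j] with [d j > 1] have [alpha_j != 0], a value whose sum has no
    constant coefficient must be 0.  Indeed some [b i] is then 0, and so is every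
    [w_j] with [d j > 1] ([weight_eq0]).

    For the lower bounds it is enough to choose [j] with [alpha_j != 0] and to
    substitute [1] for all variables but [x_j].  If [x_j] takes the value [p],
    with constant coefficient [b], the result is
      [(alpha_j b^(d_j - 1) p + (s - alpha_j) b^(d_j)) X^(n-1)]
    by [single_value_in_image].  Reaching [q X^(n-1)] requires
    [s b^(d_j) = q(0)], and conversely, given such a [b] with
    [alpha_j b^(d_j - 1) != 0], one solves for [p], whose constant coefficient
    is then automatically [b] ([image_of_root]).  If [s = 0], only targets with
    [q(0) = 0] matter, and [b = 1] works.  If [s != 0] and [d_j = 1], the equation
    is linear in [b], and [b = 0] is harmless since [b^(d_j - 1) = 1].  Otherwise
    only [q(0) != 0] matters, and algebraic closedness provides a root [b],
    which is nonzero. *)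

(** * The lower central series of the algebra *)

Lemma Linf_mulE (K : fieldType) (u v : Linf K) :
  u ** v = (v : {poly K})`_0 *: ((u : {poly K}) * 'X) :> {poly K}.
Proof. by []. Qed.

(** Every product is a scalar multiple of [X] times its left factor, and right
    multiplication by [e_1 = 1] is exactly multiplication by [X]. *)
Lemma lpow_LinfP (K : fieldType) (k : nat) (v : Linf K) :
  lpow (Linf K) k.+1 v <-> exists q : {poly K}, v = q * 'X^k :> {poly K}.
Proof.
elim: k v => [|k IHk] v.
  by split=> // _; exists v; rewrite expr0 mulr1.
split=> [[s [sP ->]]|[q ->]].
  elim: s sP => [|p s IHs] sP; first by exists 0; rewrite big_nil mul0r.
  have [|r rE] := IHs; first by move=> x xs; apply: sP; rewrite inE xs orbT.
  move: (sP p (mem_head _ _)) => [x [y [/IHk [t xE] _ pE]]].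
  have {}pE : p.2 = (y : {poly K})`_0 *: (t * 'X^k * 'X) :> {poly K}.
    by rewrite pE Linf_mulE xE.
  exists (p.1 *: ((y : {poly K})`_0 *: t) + r).
  rewrite big_cons; transitivity (p.1 *: (p.2 : {poly K}) + r * 'X^(k.+1)).
    by rewrite -rE.
  by rewrite pE mulrDl -!scalerAl -mulrA -exprSr.
exists [:: (1, (q * 'X^(k.+1) : Linf K))]; split=> [p|].
  rewrite inE => /eqP -> /=; exists (q * 'X^k : {poly K}), (1 : {poly K}).
  split=> //; first by apply/IHk; exists q.
  have -> : lmul (q * 'X^k : Linf K) (1 : {poly K}) = (q * 'X^k * 'X : {poly K}).
    by rewrite Linf_mulE coef1 scale1r.
  by rewrite exprSr mulrA.
by rewrite big_seq1 scale1r.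
Qed.

(** * Values of the normal form *)

(** The degrees in the factor that multiplies [x_j] in the [j]-th normal
    monomial. *)
Definition codeg {m : nat} (d : 'I_m -> nat) (j i : 'I_m) : nat :=
  if i == j then (d i).-1 else d i.

Definition weight {R : comNzRingType} {m : nat} (d : 'I_m -> nat) (b : 'I_m -> R)
    (j : 'I_m) : R :=
  \prod_(i < m) b i ^+ codeg d j i.

Definition normal_value {K : fieldType} {m : nat} (d : 'I_m -> nat) (alpha : 'I_m -> K)
    (a : 'I_m -> {poly K}) : {poly K} :=
  \sum_(j < m) (alpha j * weight d (fun i => (a i)`_0) j) *: a j.

Lemma mulpow_Linf (K : fieldType) (u v : Linf K) (s : nat) :
  mulpow u v s = ((v : {poly K})`_0 ^+ s) *: ((u : {poly K}) * 'X^s) :> {poly K}.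
Proof.
elim: s => [|s IHs]; first by rewrite !expr0 scale1r mulr1.
rewrite /mulpow iterS -/(mulpow u v s) Linf_mulE IHs.
by rewrite -scalerAl scalerA -mulrA -exprS -exprSr.
Qed.

Lemma eval_mulpow (K : fieldType) (L : leibnizType K) (a : nat -> L)
    (g h : freeLeib K) (s : nat) :
  eval a (mulpow g h s) = mulpow (eval a g) (eval a h) s.
Proof.
elim: s => // s IHs; rewrite /mulpow !iterS evalM; congr (_ ** _); exact: IHs.
Qed.

Lemma eval_foldl_mulpow (K : fieldType) m (e : 'I_m -> nat) (a : nat -> Linf K)
    (g : freeLeib K) (s : seq 'I_m) :
  eval a (foldl (fun g (i : 'I_m) => mulpow g (fl_var K i) (e i)) g s) =
  (\prod_(i <- s) (a i : {poly K})`_0 ^+ e i) *: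
    ((eval a g : {poly K}) * 'X^(\sum_(i <- s) e i)) :> {poly K}.
Proof.
elim: s g => [|i s IHs] g /=; first by rewrite !big_nil scale1r expr0 mulr1.
rewrite IHs eval_mulpow eval_var mulpow_Linf !big_cons.
by rewrite -scalerAl scalerA -mulrA -exprD [X in X *: _]mulrC.
Qed.

Lemma sum_codeg m (d : 'I_m -> nat) (j : 'I_m) : (0 < d j)%N ->
  (\sum_(i < m) codeg d j i = (\sum_(i < m) d i).-1)%N.
Proof.
move=> dj_gt0; rewrite (bigD1 j) //= [in RHS](bigD1 j) //= /codeg eqxx.
rewrite -[in RHS](prednK dj_gt0) addSn /=; congr addn.
by apply: eq_bigr => i /negPf ->.
Qed.

Lemma weightM (R : comNzRingType) m (d : 'I_m -> nat) (b : 'I_m -> R) j :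
  (0 < d j)%N -> weight d b j * b j = \prod_(i < m) b i ^+ d i.
Proof.
move=> dj_gt0; rewrite /weight (bigD1 j) //= [RHS](bigD1 j) //= /codeg eqxx.
rewrite mulrAC -exprSr prednK //; congr (_ * _).
by apply: eq_bigr => i /negPf ->.
Qed.

Lemma eval_normal_mono (K : fieldType) m (d : 'I_m -> nat) (a : nat -> Linf K)
    (j : 'I_m) : (0 < d j)%N ->
  eval a (normal_mono K d j) =
  weight d (fun i => (a i : {poly K})`_0) j *:
    ((a j : {poly K}) * 'X^((\sum_(i < m) d i).-1)) :> {poly K}.
Proof.
by move=> dj; rewrite eval_foldl_mulpow eval_var -(sum_codeg _ _ j) // !big_enum.
Qed.

Lemma eval_normal_form (K : fieldType) m (d : 'I_m -> nat) (alpha : 'I_m -> K)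
    (f : freeLeib K) (a : nat -> Linf K) :
  (forall i, 0 < d i)%N ->
  Id (Linf K) (f - \sum_(j < m) alpha j *: normal_mono K d j) ->
  eval a f = normal_value d alpha (fun i => a i) * 'X^((\sum_(i < m) d i).-1)
    :> {poly K}.
Proof.
move=> d_gt0 /(_ a); rewrite linearB => /eqP; rewrite subr_eq0 => /eqP ->.
rewrite linear_sum /normal_value mulr_suml; apply: eq_bigr => j _.
rewrite linearZ -scalerAl -scalerA -eval_normal_mono //.
Qed.

(** [x_j] and the weight that multiplies it have, together, degree [d i] in each
    [b i], so the terms differ only by the coefficients [alpha j]. *)
Lemma normal_value_coef0 (K : fieldType) m (d : 'I_m -> nat) (alpha : 'I_m -> K)
    (a : 'I_m -> {poly K}) : (forall i, 0 < d i)%N ->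
  (normal_value d alpha a)`_0 =
  (\sum_(j < m) alpha j) * \prod_(i < m) (a i)`_0 ^+ d i.
Proof.
move=> d_gt0; rewrite /normal_value coef_sum mulr_suml; apply: eq_bigr => j _.
by rewrite coefZ -mulrA weightM.
Qed.

(** Since [1 < d j], dividing the full product by one factor [b j] still leaves a
    factor [b i], even when [i = j]. *)
Lemma weight_eq0 (R : comNzRingType) m (d : 'I_m -> nat) (b : 'I_m -> R) i j :
  (0 < d i)%N -> (1 < d j)%N -> b i = 0 -> weight d b j = 0.
Proof.
move=> di dj bi0; rewrite /weight (bigD1 i) //= bi0 expr0n.
suff /negPf -> : codeg d j i != 0%N by rewrite mul0r.
rewrite -lt0n /codeg; case: eqP => [->|//].
by rewrite -ltnS prednK // ltnW.
Qed.

(** * Elements of the image obtained by moving one variable *)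

Lemma normal_value_single (K : fieldType) m (d : 'I_m -> nat)
    (alpha : 'I_m -> K) (j : 'I_m) (p : {poly K}) : (0 < d j)%N ->
  normal_value d alpha (fun i => if i == j then p else 1) =
  (alpha j * p`_0 ^+ (d j).-1) *: p
    + ((\sum_(i < m) alpha i - alpha j) * p`_0 ^+ d j)%:P.
Proof.
move=> dj.
have wE k : weight d (fun i => (if i == j then p else 1)`_0) k
    = p`_0 ^+ codeg d k j.
  rewrite /weight (bigD1 j) //= eqxx big1 ?mulr1 // => i /negPf ->.
  by rewrite coef1 expr1n.
rewrite /normal_value (bigD1 j) //= wE eqxx /codeg eqxx; congr (_ + _).
rewrite [\sum_(i < m) alpha i](bigD1 j) //= [alpha j + _]addrC addrK.
rewrite mulr_suml rmorph_sum; apply: eq_bigr => i ij.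
by rewrite wE /codeg (negPf ij) eq_sym (negPf ij) alg_polyC.
Qed.

Lemma single_value_in_image (K : fieldType) m (d : 'I_m -> nat)
    (alpha : 'I_m -> K) (f : freeLeib K) (j : 'I_m) (p : {poly K}) :
  (forall i, 0 < d i)%N ->
  Id (Linf K) (f - \sum_(j < m) alpha j *: normal_mono K d j) ->
  poly_image (Linf K) m f
    (((alpha j * p`_0 ^+ (d j).-1) *: p
       + ((\sum_(i < m) alpha i - alpha j) * p`_0 ^+ d j)%:P)
     * 'X^((\sum_(i < m) d i).-1) : {poly K}).
Proof.
move=> d_gt0 fE; rewrite -normal_value_single //.
pose t : m.-tuple (Linf K) := [tuple (if i == j then p else 1) | i < m].
exists t; rewrite (eval_normal_form K m d alpha) //; congr (normal_value _ _ _ * _).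
by apply: funext => i; rewrite -tnth_nth tnth_mktuple.
Qed.

(** The equation [s b^(d_j) = q(0)] is exactly what makes [b] the constant
    coefficient of the solution [p] of the equation that is linear in [p]. *)
Lemma image_of_root (K : fieldType) m (d : 'I_m -> nat) (alpha : 'I_m -> K)
    (f : freeLeib K) (j : 'I_m) (b : K) (q : {poly K}) :
  (forall i, 0 < d i)%N ->
  Id (Linf K) (f - \sum_(j < m) alpha j *: normal_mono K d j) ->
  alpha j * b ^+ (d j).-1 != 0 -> (\sum_(i < m) alpha i) * b ^+ d j = q`_0 ->
  poly_image (Linf K) m f (q * 'X^((\sum_(i < m) d i).-1) : {poly K}).
Proof.
move=> d_gt0 fE c_neq0 bP; set s := \sum_(i < m) alpha i in bP *.
pose c := alpha j * b ^+ (d j).-1; pose r := (s - alpha j) * b ^+ d j.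
pose p := c^-1 *: (q - r%:P).
have p0 : p`_0 = b.
  rewrite coefZ coefB coefC /= -bP -mulrBl opprB addrCA subrr addr0.
  by rewrite -[in b ^+ d j](prednK (d_gt0 j)) exprSr [alpha j * _]mulrA mulKf.
have := single_value_in_image K m d alpha f j p d_gt0 fE.
by rewrite p0 -/c -/s -/r scalerA divff // scale1r subrK.
Qed.

(** * Description of the image *)

Lemma closed_field_rootn (K : closedFieldType) (k : nat) (c : K) :
  (0 < k)%N -> exists b : K, b ^+ k = c.
Proof.
move=> k_gt0; have [b] := solve_monicpoly (fun i => if i == 0%N then c else 0) k_gt0.
case: k k_gt0 => // k _ bE; exists b; rewrite bE.
by rewrite big_ord_recl /= expr0 mulr1 big1 ?addr0 // => i _; rewrite mul0r.
Qed.

Theorem theorem21 (K : closedFieldType) (m : nat) (d : 'I_m -> nat)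
    (f : freeLeib K) (alpha : 'I_m -> K)
    (hd : forall i, (1 <= d i)%N)
    (hf : multihomogeneous d f)
    (hnf : Id (Linf K) (f - \sum_(j < m) alpha j *: normal_mono K d j)) :
  let n := (\sum_(i < m) d i)%N in
  [/\ Id (Linf K) f -> poly_image (Linf K) m f = [set 0],
      ~ Id (Linf K) f -> \sum_(i < m) alpha i = 0 ->
        poly_image (Linf K) m f = lpow (Linf K) n.+1
    & ~ Id (Linf K) f -> \sum_(i < m) alpha i <> 0 ->
        ((exists j, d j = 1%N /\ alpha j <> 0) ->
           poly_image (Linf K) m f = lpow (Linf K) n) /\
        ((forall j, d j = 1%N -> alpha j = 0) ->
           poly_image (Linf K) m f =
             [set 0] `|`
             [set u : Linf K | exists (lambda : K) (v : Linf K),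
                [/\ lambda <> 0, lpow (Linf K) n.+1 v
                  & u = lambda *: Linf_e K n + v]])].
Proof.
move=> n.
have fE (a : nat -> Linf K) := eval_normal_form K m d alpha f a hd hnf.
have imR := fun j b q => image_of_root K m d alpha f j b q hd hnf.
have ex_alpha : ~ Id (Linf K) f -> exists j, alpha j != 0.
  move=> nId; apply: contrapT => /forallNP alpha0; apply: nId => a.
  rewrite fE /normal_value big1 ?mul0r // => j _.
  by have /negP/negPn/eqP -> := alpha0 j; rewrite mul0r scale0r.
have n_gt0 (j : 'I_m) : (0 < n)%N.
  by rewrite /n (bigD1 j) //= addn_gt0 hd.
have split0 (q : {poly K}) : exists r : {poly K}, q = r * 'X + (q`_0)%:P.
  elim/poly_ind: q => [|q c _]; first by exists 0; rewrite mul0r add0r coefC.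
  by exists q; rewrite coefD coefMX coefC add0r.
have image0 : poly_image (Linf K) m f 0.
  exists [tuple 0 | i < m]; rewrite fE /normal_value big1 ?mul0r // => i _.
  by rewrite -tnth_nth tnth_mktuple scaler0.
split.
- move=> fId; apply/seteqP; split=> [v [a <-]|v ->] //; exact: fId.
- move=> /ex_alpha [j aj] s0; have nE := prednK (n_gt0 j).
  apply/seteqP; split=> v.
    case=> a <-; apply/lpow_LinfP; rewrite fE.
    set N := normal_value _ _ _; have [r ->] := split0 N.
    rewrite normal_value_coef0 // s0 mul0r addr0; exists r.
    by rewrite -mulrA -exprS nE.
  move=> /lpow_LinfP [q ->].
  rewrite -nE exprS mulrA; apply: (imR j 1); first by rewrite expr1n mulr1.
  by rewrite s0 mul0r coefMX eqxx.
- move=> /ex_alpha [j0 aj0] /eqP s0; have nE := prednK (n_gt0 j0).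
  split=> [[j [dj /eqP aj]]|alpha_d1].
    apply/seteqP; split=> v.
      by case=> a <-; rewrite -nE; apply/lpow_LinfP; rewrite fE; eexists.
    rewrite -nE => /lpow_LinfP [q ->].
    apply: (imR j (q`_0 / \sum_(i < m) alpha i)).
      by rewrite dj expr0 mulr1.
    by rewrite dj expr1 mulrC divfK.
  apply/seteqP; split=> v.
    case=> a <-; rewrite fE; set N := normal_value _ _ _.
    have [/eqP N0|N0] := boolP (N`_0 == 0); [left|right].
      (* The constant coefficient is [s] times a product of powers, so some
         variable has been given a value without constant coefficient. *)
      move: N0; rewrite normal_value_coef0 // => /eqP.
      rewrite mulf_eq0 (negPf s0) => /prodf_eq0 [i _].
      rewrite expf_eq0 => /andP [_ /eqP ai0].
      suff -> : N = 0 by rewrite mul0r.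
      apply: big1 => k _; case: (eqVneq (d k) 1%N) => [/alpha_d1 ->|dk].
        by rewrite mul0r scale0r.
      by rewrite (weight_eq0 _ _ _ _ i) ?mulr0 ?scale0r // ltn_neqAle eq_sym dk hd.
    have [r NE] := split0 N.
    exists N`_0, (r * 'X^n : {poly K}); split; first exact/eqP.
      by apply/lpow_LinfP; exists r.
    rewrite [in LHS]NE mulrDl -mulrA -exprS nE addrC mul_polyC //.
  case=> [->//|[l [w [/eqP l0 /lpow_LinfP [q ->] ->]]]].
  have [b bE] := closed_field_rootn K (d j0) (l / \sum_(i < m) alpha i) (hd j0).
  have b0 : b != 0.
    apply/eqP => b0; move: bE; rewrite b0 expr0n (negPf (lt0n_neq0 (hd j0))).
    by move/esym/eqP; rewrite mulf_eq0 invr_eq0 (negPf l0) (negPf s0).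
  have -> : l *: Linf_e K n + q * 'X^n = (l%:P + q * 'X) * 'X^(n.-1) :> {poly K}.
    by rewrite mulrDl -mulrA -exprS nE mul_polyC.
  apply: (imR j0 b); first by rewrite mulf_neq0 ?expf_neq0.
  by rewrite bE mulrC divfK // coefD coefC coefMX addr0.
Qed.
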